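(* If $x^\star\in\mathbb{R}^n$ is a locally optimal point of (MPBVC) at which BVC-LICQ holds, then $x^\star$ is a strongly stationary point of (MPBVC).
   Context: Setting. Let $f,H_i,G_{i,j}:\mathbb{R}^n\to\mathbb{R}$ ($1\le i\le n_H$, $1\le j\le n_G$, with $n_H,n_G\ge1$), $g:\mathbb{R}^n\to\mathbb{R}^{n_g}$, $h:\mathbb{R}^n\to\mathbb{R}^{n_h}$ be twice continuously differentiable. (MPBVC) is the problem: minimize $f(x)$ subject to $g(x)=0$, $h(x)\ge0$, $H_i(x)\ge0$ for all $i$, and $G_{i,j}(x)H_i(x)\ge0$ for all $(i,j)$. Index sets at a feasible point $x^\star$: let $\mathcal{I}_{(+,+)},\mathcal{I}_{(+,0)}$ be the sets of $(i,j)$ with $H_i(x^\star)>0$ and $G_{i,j}(x^\star)>0$, $=0$ respectively; let $\mathcal{I}_{(0,+)},\mathcal{I}_{(0,0)},\mathcal{I}_{(0,-)}$ be the sets of $(i,j)$ with $H_i(x^\star)=0$ and $G_{i,j}(x^\star)>0$, $=0$, $<0$ respectively. For each of these, $\mathcal{I}^H_{(\cdot,\cdot)}=\{i\mid \exists j:(i,j)\in\mathcal{I}_{(\cdot,\cdot)}\}$. Let $\mathcal{I}_0^H=\{i\mid H_i(x^\star)=0\}$ and $\mathcal{I}_h=\{l\mid h_l(x^\star)=0\}$. BVC-LICQ holds at $x^\star$ if the gradients $\nabla g_k(x^\star)$ (all $k$), $\nabla h_l(x^\star)$ ($l\in\mathcal{I}_h$), $\nabla H_i(x^\star)$ ($i\in\mathcal{I}_0^H$),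 $\nabla G_{i,j}(x^\star)$ ($(i,j)\in\mathcal{I}_{(0,0)}\cup\mathcal{I}_{(+,0)}$) are linearly independent. Strong stationarity of $x^\star$: there exist $\mu^g\in\mathbb{R}^{n_g}$, $\mu^h\in\mathbb{R}^{n_h}$, $\mu^G\in\mathbb{R}^{n_G\cdot n_H}$, $\mu^H\in\mathbb{R}^{n_H}$ with $\nabla f(x^\star)-\sum_{k}\mu^g_k\nabla g_k(x^\star)-\sum_{l}\mu^h_l\nabla h_l(x^\star)-\sum_{(i,j)}\mu^G_{ij}\nabla G_{i,j}(x^\star)-\sum_i\mu^H_i\nabla H_i(x^\star)=0$; $g(x^\star)=0$; $\mu^h_l\ge0$, $h_l(x^\star)\ge0$, $\mu^h_lh_l(x^\star)=0$ for all $l$; $\mu^H_i=0$ for $i\in\mathcal{I}^H_{(+,+)}\cup\mathcal{I}^H_{(+,0)}$; $\mu^H_i\ge0$ for $i\in\mathcal{I}_0^H$ such that no $j$ satisfies $(i,j)\in\mathcal{I}_{(0,-)}$; $\mu^H_i$ free for $i\in\mathcal{I}_0^H$ such that some $j$ satisfies $(i,j)\in\mathcal{I}_{(0,-)}$; $\mu^G_{ij}\ge0$ for $(i,j)\in\mathcal{I}_{(+,0)}$ and $\mu^G_{ij}=0$ otherwise. *)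

(* Defs.v *)
From HB Require Import structures.
From mathcomp Require Import all_boot all_order all_algebra.
From mathcomp Require Import all_classical all_reals all_analysis.

Set Implicit Arguments.
Unset Strict Implicit.
Unset Printing Implicit Defensive.

Import Order.TTheory GRing.Theory Num.Theory.
Import numFieldNormedType.Exports.

Local Open Scope ring_scope.

(* F is Fréchet differentiable everywhere and its differential depends
   continuously on the point.  Since R^n is finite-dimensional, continuity of
   x |-> 'd F x for the operator norm amounts to continuity of x |-> 'D_v F x
   for every fixed direction v. *)
Definition C1 (R : realType) (n : nat) (W : normedModType R)
    (F : 'rV[R]_n -> W) : Prop :=
  (forall x, differentiable F x) /\
  (forall v : 'rV[R]_n, continuous (fun x => 'D_v F x)).

Definition C2 (R : realType) (n : nat) (W : normedModType R)
    (F : 'rV[R]_n -> W) : Prop :=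
  C1 F /\ (forall v : 'rV[R]_n, C1 (fun x => 'D_v F x)).

Definition grad (R : realType) (n : nat) (f : 'rV[R]_n -> R)
    (x : 'rV[R]_n) : 'rV[R]_n :=
  \row_(i < n) 'D_(delta_mx 0 i) f x.

(*   minimize f x   subject to   g x = 0,   h x >= 0,   H_i x >= 0,
     G_{i,j} x * H_i x >= 0   for all i < nH, j < nG. *)
Record mpbvc (R : realType) (n ng nh nH nG : nat) := MPBVC {
  objf : 'rV[R]_n -> R;
  eqg : 'rV[R]_n -> 'rV[R]_ng;
  ineqh : 'rV[R]_n -> 'rV[R]_nh;
  bvcH : 'I_nH -> 'rV[R]_n -> R;
  bvcG : 'I_nH -> 'I_nG -> 'rV[R]_n -> R
}.

Section Mpbvc.
Variables (R : realType) (n ng nh nH nG : nat).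
Variable P : mpbvc R n ng nh nH nG.
Implicit Types x y : 'rV[R]_n.

Definition mpbvc_C2 : Prop :=
  [/\ C2 (objf P), C2 (eqg P), C2 (ineqh P),
      (forall i, C2 (bvcH P i)) & (forall i j, C2 (bvcG P i j))].

Definition feasible x : Prop :=
  [/\ eqg P x = 0,
      (forall l, 0 <= ineqh P x 0 l),
      (forall i, 0 <= bvcH P i x) &
      (forall i j, 0 <= bvcG P i j x * bvcH P i x)].

Definition locally_optimal x : Prop :=
  feasible x /\ (\forall y \near x, feasible y -> objf P x <= objf P y).

(* First sign in the name: H_i; second sign: G_{i,j}
   (p is > 0, z is = 0, m is < 0). *)
Definition Ipp x : {set 'I_nH * 'I_nG} :=
  [set ij | (0 < bvcH P ij.1 x) && (0 < bvcG P ij.1 ij.2 x)]%SET.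
Definition Ipz x : {set 'I_nH * 'I_nG} :=
  [set ij | (0 < bvcH P ij.1 x) && (bvcG P ij.1 ij.2 x == 0)]%SET.
Definition Izp x : {set 'I_nH * 'I_nG} :=
  [set ij | (bvcH P ij.1 x == 0) && (0 < bvcG P ij.1 ij.2 x)]%SET.
Definition Izz x : {set 'I_nH * 'I_nG} :=
  [set ij | (bvcH P ij.1 x == 0) && (bvcG P ij.1 ij.2 x == 0)]%SET.
Definition Izm x : {set 'I_nH * 'I_nG} :=
  [set ij | (bvcH P ij.1 x == 0) && (bvcG P ij.1 ij.2 x < 0)]%SET.

Definition projH (I : {set 'I_nH * 'I_nG}) : {set 'I_nH} :=
  [set i | [exists j, (i, j) \in I]]%SET.

Definition I0H x : {set 'I_nH} := [set i | bvcH P i x == 0]%SET.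

Definition Ih x : {set 'I_nh} := [set l | ineqh P x 0 l == 0]%SET.

Definition grad_g k x : 'rV[R]_n := grad (fun y => eqg P y 0 k) x.
Definition grad_h l x : 'rV[R]_n := grad (fun y => ineqh P y 0 l) x.
Definition grad_H i x : 'rV[R]_n := grad (bvcH P i) x.
Definition grad_G i j x : 'rV[R]_n := grad (bvcG P i j) x.

(* The gradients form a sequence rather than a set, so that a gradient occurring
   for two different indices counts as a linear dependence. *)
Definition BVC_LICQ x : Prop :=
  free ([seq grad_g k x | k : 'I_ng]
        ++ [seq grad_h l x | l in Ih x]
        ++ [seq grad_H i x | i in I0H x]
        ++ [seq grad_G ij.1 ij.2 x | ij in (Izz x :|: Ipz x)%SET]).

(* The multiplier muH 0 i carries no sign condition when i \in I0H x and
   i \in projH (Izm x). *)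
Definition strongly_stationary x : Prop :=
  exists (mug : 'rV[R]_ng) (muh : 'rV[R]_nh)
         (muG : 'M[R]_(nH, nG)) (muH : 'rV[R]_nH),
  [/\ grad (objf P) x
      - \sum_(k < ng) mug 0 k *: grad_g k x
      - \sum_(l < nh) muh 0 l *: grad_h l x
      - \sum_(i < nH) \sum_(j < nG) muG i j *: grad_G i j x
      - \sum_(i < nH) muH 0 i *: grad_H i x = 0,
      eqg P x = 0,
      (forall l, [/\ 0 <= muh 0 l, 0 <= ineqh P x 0 l &
                     muh 0 l * ineqh P x 0 l = 0]),
      (forall i, i \in (projH (Ipp x) :|: projH (Ipz x))%SET -> muH 0 i = 0) /\
      (forall i, i \in I0H x -> i \notin projH (Izm x) -> 0 <= muH 0 i) &
      (forall i j, (i, j) \in Ipz x -> 0 <= muG i j) /\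
      (forall i j, (i, j) \notin Ipz x -> muG i j = 0)].

End Mpbvc.

(* Main.v *)
From HB Require Import structures.
Require Import Defs.
From mathcomp Require Import all_boot all_order all_algebra.
From mathcomp Require Import all_classical all_reals all_analysis.
From mathcomp Require Import ring lra.
Import Order.TTheory GRing.Theory Num.Theory.
Import numFieldNormedType.Exports.
Local Open Scope classical_set_scope.
Local Open Scope ring_scope.

Set Implicit Arguments.
Unset Strict Implicit.
Unset Printing Implicit Defensive.

(* Let F_k be the constraint functions whose gradients enter BVC-LICQ.  Since
   these gradients are linearly independent, Graves' theorem (a contraction
   argument) gives, for every direction d with dF_k(d) = c_k and all small
   t > 0, a point y = x + t d + o(t) with F_k(y) = t c_k for all k.  Whenever
   the pattern c makes all such y feasible, local optimality yields
   df(d) >= 0.  The pattern c = 0 shows that grad f = sum_k lam_k grad F_k,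
   and then c yields sum_k lam_k c_k >= 0.  Unit patterns, taken with both
   signs where that preserves feasibility, give the sign conditions: for G_ij
   with (i,j) in I_(0,0) both signs are allowed because H_i stays 0, so that
   multiplier vanishes; H_i may increase as soon as no G_ij is negative. *)

(* Matrices are both complete and normed in the library, but not declared as a
   complete normed module, which Banach's fixed point theorem requires. *)
HB.instance Definition _ (R : realType) (m n : nat) :=
  Complete.copy 'M[R]_(m, n) 'M[R]_(m, n).

(** * Strict differentiability of continuously differentiable functions *)

Section differential.
Variables (R : realType) (n : nat).
Implicit Types (f : 'rV[R]_n -> R) (x v : 'rV[R]_n).

Lemma mxnorm_le m p (M : 'M[R]_(m, p)) (e : R) : 0 <= e ->
  (forall i j, `|M i j| <= e) -> `|M| <= e.
Proof.
move=> e0 Me; rewrite -[`|M|]/(mx_norm M) mx_normrE.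
by apply: bigmax_le => //= ij _; exact: Me.
Qed.

Lemma coord_le_mxnorm m p (M : 'M[R]_(m, p)) i j : `|M i j| <= `|M|.
Proof.
rewrite -[`|M|]/(mx_norm M) mx_normrE.
exact: (le_bigmax _ (fun ij => `|M ij.1 ij.2|) (i, j)).
Qed.

Lemma derive_coord_sum f x v : differentiable f x ->
  'D_v f x = \sum_i v 0 i * 'D_(delta_mx 0 i) f x.
Proof.
move=> df; rewrite deriveE// {1}(row_sum_delta v) linear_sum/=.
by apply: eq_bigr => i _; rewrite linearZ/= deriveE.
Qed.

Lemma C1_coord m (F : 'rV[R]_n -> 'rV[R]_m) j :
  C1 F -> C1 (fun y => F y 0 j).
Proof.
move=> [dF cF].
have dFj y : differentiable (fun y => F y 0 j) y.
  apply: (differentiable_comp (g := fun M : 'rV[R]_m => M 0 j)) => //.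
  exact: differentiable_coord.
split => // v y.
rewrite (_ : (fun y => 'D_v _ y) = (fun y => ('D_v F y) 0 j)); last first.
  apply/funext => z; apply/cvg_lim => //.
  have /= := @diff_derivable _ _ _ F z v (dF z).
  move=> /(@cvg_comp _ _ _ _ (fun M : 'rV[R]_m => M 0 j)) H.
  have := H _ (@coord_continuous _ _ _ 0 j _).
  by apply: cvg_trans; apply: near_eq_cvg; near=> h; rewrite /= !mxE.
apply: (@continuous_comp _ _ _ (fun y => 'D_v F y) (fun M : 'rV[R]_m => M 0 j)).
  exact: cF.
exact: coord_continuous.
Unshelve. all: by end_near. Qed.

Lemma mean_value_line f : (forall x, differentiable f x) -> forall y z,
  exists2 s, s \in `[0, 1] & f y - f z = 'D_(y - z) f (z + s *: (y - z)).
Proof.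
move=> df y z; set v := y - z; pose phi (s : R) := f (z + s *: v).
(* The difference quotients agree exactly, so [phi] inherits derivability and derivative from [f]
   along [v]. *)
have growth s : (fun h : R => h^-1 *: (phi (h *: 1 + s) - phi s)) =
    (fun h : R => h^-1 *: (f (h *: v + (z + s *: v)) - f (z + s *: v))).
  by apply/funext => h; rewrite /phi [h *: 1]mulr1 scalerDl addrCA.
have dphi (s : R) : is_derive s (1 : R) phi ('D_v f (z + s *: v)).
  apply: DeriveDef; last by rewrite /derive growth.
  by rewrite /derivable growth; exact: diff_derivable.
have [|s s01 E] := MVT_segment (@ler01 R) (fun s _ => dphi s).
  by apply: derivable_within_continuous => s _; exact: ex_derive.
exists s => //; move: E.
by rewrite /phi scale1r scale0r addr0 subr0 mulr1 /v subrKC.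
Qed.

(* The mean value theorem turns continuity of the differential into strict
   differentiability. *)
Lemma C1_strict_differentiable f x (e : R) : C1 f -> 0 < e ->
  \forall r \near 0^'+, forall y z, ball x r y -> ball x r z ->
    `|f y - f z - 'd f x (y - z)| <= e * `|y - z|.
Proof.
move=> [df cf] e0.
(* Summing [n] such bounds costs at most [e]; [n.+1] avoids a zero denominator when [n] is 0. *)
have : \forall u \near x, forall i : 'I_n,
    `|'D_(delta_mx 0 i) f x - 'D_(delta_mx 0 i) f u| <= e / n.+1%:R.
  apply: (@filter_forall _ _ _ _ (nbhs_filter x)) => i.
  by move/cvgrPdist_le : (cf (delta_mx 0 i) x); apply; rewrite divr_gt0.
move=> /nbhs_ballP[r0 /= r0_gt0 cont]; near=> r => y z xy xz.
have [s s01 ->] := mean_value_line df y z.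
set u := z + _.
have xu : ball x r u.
  move: xy xz; rewrite -!ball_normE /ball_/= => xy xz.
  have -> : x - u = (1 - s) *: (x - z) + s *: (x - y).
    rewrite /u; apply/rowP => i; rewrite !mxE; ring.
  rewrite (le_lt_trans (ler_normD _ _))// !normrZ.
  move: s01; rewrite in_itv/= => /andP[s0 s1].
  rewrite (ger0_norm s0) ger0_norm ?subr_ge0//.
  (* Strictness comes from the first term, which vanishes for [s = 1]; there the second term alone
     is below [r]. *)
  have [s_1|s_1] := ltrP s 1.
    rewrite [ltRHS](_ : r = (1 - s) * r + s * r); last by ring.
    rewrite ltr_leD//.
      by rewrite ltr_pM2l ?subr_gt0.
    by rewrite ler_wpM2l// ltW.
  have -> : s = 1 by apply/le_anti/andP.
  by rewrite subrr mul0r add0r mul1r.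
have r_r0 : r <= r0 by near: r; exact: nbhs_right_le.
have {}cont := cont _ (le_ball r_r0 xu).
rewrite -deriveE// !derive_coord_sum// -sumrB.
rewrite (le_trans (ler_norm_sum _ _ _))//.
rewrite (@le_trans _ _ (\sum_(i < n) (e / n.+1%:R * `|y - z|)))//.
  apply: ler_sum => i _; rewrite -mulrBr normrM mulrC.
  by apply: ler_pM; rewrite ?coord_le_mxnorm// distrC.
rewrite sumr_const card_ord -mulrnAl ler_wpM2r//.
by rewrite -[leLHS]mulr_natr mulrAC ler_pdivrMr// ler_wpM2l ?ltW// ltr_nat.
Unshelve. all: by end_near. Qed.

End differential.

(** * Curves with prescribed constraint values, and the multipliers they yield *)

Section multipliers.
Variables (R : realType) (n m : nat) (F : 'I_m -> 'rV[R]_n -> R).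
Variables (x : 'rV[R]_n) (B : 'M[R]_(m, n)).
Hypothesis F_C1 : forall i, C1 (F i).
Hypothesis Fx0 : forall i, F i x = 0.
(** [B] gives a right inverse of the joint differential of the [F i]; this encodes the independence
    of the gradients. *)
Hypothesis dFB : forall u i, 'd (F i) x (u *m B) = u 0 i.

Lemma mulmx_bound :
  exists2 K : R, 0 < K & forall u : 'rV[R]_m, `|u *m B| <= K * `|u|.
Proof.
exists (m%:R * `|B| + 1) => [|u]; first by rewrite ltr_wpDl// mulr_ge0.
apply: mxnorm_le => [|i j]; first by rewrite mulr_ge0// addr_ge0// mulr_ge0.
rewrite mxE (le_trans (ler_norm_sum _ _ _))//.
rewrite (@le_trans _ _ (\sum_(k < m) (`|B| * `|u|)))//.
  apply: ler_sum => k _; rewrite normrM mulrC.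
  by apply: ler_pM; rewrite ?coord_le_mxnorm.
rewrite sumr_const card_ord -mulrnAl ler_wpM2r// -[leLHS]mulr_natl.
by rewrite lerDl.
Qed.

(* Graves' theorem: the correction [u *m B] is the fixed point of a Newton-like
   iteration with frozen differential. *)
Lemma tangent_curve (c : 'I_m -> R) d (e : R) :
  (forall i, 'd (F i) x d = c i) -> 0 < e ->
  \forall t \near 0^'+, exists2 y, `|y - (x + t *: d)| <= e * t &
    forall i, F i y = t * c i.
Proof.
move=> dFd e0; have [K K0 BK] := mulmx_bound.
(* Chosen for two bounds: [eta * K <= 1 / 2] makes the iteration a contraction, and
   [eta * K * |d| <= e / 2] makes its first step at most half the radius. *)
pose eta := Num.min 1 e / (2 * K * (`|d| + 1)).
have d1 : 0 < `|d| + 1 by rewrite ltr_wpDl.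
have eta0 : 0 < eta by rewrite divr_gt0 ?lt_min ?ltr01// mulr_gt0// mulr_gt0.
have Kd : 0 <= K * `|d| by rewrite mulr_ge0// ltW.
have etaKd : eta * K * (`|d| + 1) = Num.min 1 e / 2.
  by rewrite /eta; field; rewrite !gt_eqF.
have min1 : Num.min 1 e <= 1 by rewrite ge_min lexx.
have mine : Num.min 1 e <= e by rewrite ge_min lexx orbT.
have etaK0 : 0 < eta * K by rewrite mulr_gt0.
have etaKd0 : 0 <= eta * K * `|d| by rewrite mulr_ge0// ltW.
have etaK : eta * K <= 1 / 2 by lra.
have etad : eta * K * `|d| <= e / 2 by lra.
have [r r0 Fr] : exists2 r : R, 0 < r &
    forall i y z, ball x r y -> ball x r z ->
    `|F i y - F i z - 'd (F i) x (y - z)| <= eta * `|y - z|.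
  near (0 : R)^'+ => r; exists r => //.
  near: r; apply: filter_forall => i.
  exact: C1_strict_differentiable.
have de0 : 0 < `|d| + e by rewrite ltr_wpDl.
near=> t.
have t0 : 0 < t by near: t; exact: nbhs_right_gt.
have tr : t * (`|d| + e) < r.
  rewrite -ltr_pdivlMr//; near: t; apply: nbhs_right_lt.
  by rewrite divr_gt0.
(* A correction [u] of norm at most [rho] moves the point by at most [e * t]. *)
pose rho := e * t / K.
have rho0 : 0 < rho by rewrite divr_gt0// mulr_gt0.
have Krho : K * rho = e * t by rewrite /rho mulrC divfK// gt_eqF.
pose X (u : 'rV[R]_m) := x + t *: d + u *m B.
pose U := closed_ball (0 : 'rV[R]_m) rho.
have UE u : U u = (`|u| <= rho) :> Prop.
  by rewrite /U closed_ballE// /closed_ball_/= sub0r normrN.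
have BU u : U u -> `|u *m B| <= e * t.
  by rewrite UE => Uu; rewrite -Krho (le_trans (BK u))// ler_wpM2l// ltW.
have XU u : U u -> ball x r (X u).
  move=> /BU uB; rewrite -ball_normE /ball_/= distrC.
  rewrite /X -(addrA x) [x + _]addrC addrK.
  rewrite (le_lt_trans (ler_normD _ _))// (le_lt_trans _ tr)//.
  by rewrite normrZ gtr0_norm// mulrDr lerD2l mulrC.
(* Fixed points of [T] are exactly the [u] with [F i (X u) = t * c i] for all [i]. *)
pose T (u : 'rV[R]_m) : 'rV[R]_m := \row_i (u 0 i - (F i (X u) - t * c i)).
(* By [dFB], the entries of [T u - T v] are, up to sign, the linearization errors of the [F i]
   between [X u] and [X v]. *)
have contr u v : U u -> U v -> `|T u - T v| <= 1 / 2 * `|u - v|.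
  move=> Uu Uv; apply: mxnorm_le => [|i0 i]; first by rewrite mulr_ge0.
  have XE : X u - X v = (u - v) *m B.
    by rewrite /X opprD addrACA subrr add0r mulmxBl.
  have := Fr i _ _ (XU u Uu) (XU v Uv); rewrite XE dFB !mxE distrC.
  rewrite (_ : _ - _ = u 0 i - (F i (X u) - t * c i)
      - (v 0 i - (F i (X v) - t * c i))); last by ring.
  move=> /le_trans; apply.
  rewrite (le_trans (ler_wpM2l (ltW eta0) (BK _)))// mulrA.
  by rewrite ler_wpM2r.
have U0 : U 0 by rewrite UE normr0 ltW.
have T0 : `|T 0| <= rho / 2.
  apply: mxnorm_le => [|i0 i]; first by rewrite ltW// divr_gt0.
  have := Fr i _ _ (XU 0 U0) (ballxx x r0); rewrite Fx0 subr0 !mxE.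
  have -> : X 0 - x = t *: d by rewrite /X mul0mx addr0 addrC addKr.
  rewrite linearZ/= dFd normrZ gtr0_norm// sub0r normrN => /le_trans; apply.
  have -> : rho / 2 = t * (e / 2) / K by rewrite /rho; field; rewrite gt_eqF.
  by rewrite ler_pdivlMr// mulrCA -mulrA ler_wpM2l ?(ltW t0)// mulrAC.
(* [|T u| <= |T u - T 0| + |T 0| <= rho / 2 + rho / 2]. *)
have TU : isFun _ _ U U T.
  split => u Uu; rewrite UE -[T u](subrK (T 0)) (le_trans (ler_normD _ _))//.
  have := contr _ _ Uu U0; rewrite subr0; move: Uu; rewrite UE; lra.
pose Tf : {fun U >-> U} := HB.pack T TU.
have [||u Uu uE] :=
  @banach_fixed_point R _ U Tf _ (@closed_ball_closed _ _ _ _).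
- exists (1 / 2)%:nng; split => /=; first lra.
  by move=> [u v] [/= Uu Uv]; exact: contr.
- by exists 0.
exists (X u) => [|i]; first by rewrite /X addrC addKr BU.
move: uE => /rowP/(_ i); rewrite mxE => /eqP.
by rewrite -subr_eq0 opprB addrC subrK subr_eq0 => /eqP.
Unshelve. all: by end_near. Qed.

Variables (f : 'rV[R]_n -> R) (S : set 'rV[R]_n).
Hypothesis f_C1 : C1 f.
Hypothesis fmin : \forall y \near x, S y -> f x <= f y.

(** The neighbourhood is fixed before [t], since the curve point to which this applies itself varies
    with [t]. *)
Let admissible (c : 'I_m -> R) := \forall y \near x,
  forall t, 0 < t -> (forall i, F i y = t * c i) -> S y.

(** If the derivative were [- a < 0], then at a tangent curve point [y] the error of linearizing [f]
    and the error from [y - (x + t *: d)] are each at most [t * a / 4]. Hence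
    [f y - f x <= - t * a / 2], against minimality. *)
Lemma admissible_diff_ge0 c d : admissible c ->
  (forall i, 'd (F i) x d = c i) -> 0 <= 'd f x d.
Proof.
move=> adm dFd; rewrite leNgt; apply/negP; rewrite -oppr_gt0.
set a := - _ => a0.
have [k k0 dfk] : exists2 k : R, 0 < k & forall v, `|'d f x v| <= k * `|v|.
  exact/linear_lipschitz/diff_continuous/(f_C1.1 x).
have d1 : 0 < `|d| + 1 by rewrite ltr_wpDl.
pose eta := a / (4 * (`|d| + 1)).
have eta0 : 0 < eta by rewrite divr_gt0// mulr_gt0.
pose e := Num.min 1 (a / (4 * k)).
have e0 : 0 < e by rewrite lt_min ltr01 divr_gt0// mulr_gt0.
have ke : k * e <= a / 4.
  rewrite mulrC -ler_pdivlMr// (@le_trans _ _ (a / (4 * k)))//.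
    by rewrite ge_min lexx orbT.
  by rewrite invfM mulrA.
have [r r0 fr] : exists2 r : R, 0 < r & forall y, ball x r y ->
    [/\ `|f y - f x - 'd f x (y - x)| <= eta * `|y - x|, S y -> f x <= f y &
     forall t, 0 < t -> (forall i, F i y = t * c i) -> S y].
  have [r1 /= r10 fr1] := (nbhs_ballP _ _).1 (filterI fmin adm).
  near (0 : R)^'+ => r; exists r => // y xy; split.
  - have r_gt0 : 0 < r by near: r; exact: nbhs_right_gt.
    apply: (near (C1_strict_differentiable x f_C1 eta0) r) => //.
    exact: ballxx.
  - by apply: (fr1 y _).1; apply: le_ball xy; near: r; exact: nbhs_right_le.
  - by apply: (fr1 y _).2; apply: le_ball xy; near: r; exact: nbhs_right_le.
near (0 : R)^'+ => t.
have t0 : 0 < t by near: t; exact: nbhs_right_gt.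
have [y yt Fy] : exists2 y, `|y - (x + t *: d)| <= e * t &
    forall i, F i y = t * c i.
  by near: t; exact: tangent_curve.
have yx : `|y - x| <= t * (`|d| + 1).
  have -> : y - x = y - (x + t *: d) + t *: d by rewrite opprD addrA subrK.
  rewrite (le_trans (ler_normD _ _))// normrZ gtr0_norm// mulrDr mulr1 addrC.
  by rewrite lerD2l (le_trans yt)// -[leRHS]mul1r ler_wpM2r ?(ltW t0)// ge_min lexx.
have xy : ball x r y.
  rewrite -ball_normE /ball_/= distrC (le_lt_trans yx)// -ltr_pdivlMr//.
  by near: t; apply: nbhs_right_lt; rewrite divr_gt0.
have [fy fmy Sy] := fr y xy.
have {}fmy := fmy (Sy t t0 Fy).
have etay : eta * `|y - x| <= t * a / 4.
  rewrite (le_trans (ler_wpM2l (ltW eta0) yx))// /eta le_eqVlt; apply/orP; left.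
  by apply/eqP; field; rewrite gt_eqF.
have dfw : `|'d f x (y - (x + t *: d))| <= t * a / 4.
  rewrite (le_trans (dfk _))// (le_trans (ler_wpM2l (ltW k0) yt))// mulrA.
  by rewrite -(mulrA t) [leRHS]mulrC ler_wpM2r// ltW.
have dfE : 'd f x (y - x) = 'd f x (y - (x + t *: d)) - t * a.
  rewrite /a mulrN opprK -[t * _]/(t *: _) -linearZ -linearD/=.
  by rewrite opprD addrA subrK.
move: fy dfw; rewrite dfE !ler_norml => /andP[_ fy] /andP[_ dfw].
have := mulr_gt0 t0 a0; lra.
Unshelve. all: by end_near. Qed.

(** The multiplier of [F i] is the derivative of [f] along row [i] of [B]; combining these rows with
    coefficients [c] gives a direction realising the pattern [c]. *)
Lemma constrained_multipliers : admissible (fun=> 0) ->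
  grad f x = \sum_i 'd f x (row i B) *: grad (F i) x /\
  forall c, admissible c -> 0 <= \sum_i c i * 'd f x (row i B).
Proof.
move=> adm0.
have dfB (u : 'rV[R]_m) : 'd f x (u *m B) = \sum_i u 0 i * 'd f x (row i B).
  rewrite mulmx_sum_row linear_sum/=.
  by apply: eq_bigr => i _; rewrite linearZ.
split=> [|c admc]; last first.
  have := admissible_diff_ge0 admc (d := (\row_i c i) *m B).
  rewrite dfB; under eq_bigr do rewrite mxE.
  by apply=> i; rewrite dFB mxE.
have df v : 'd f x v = \sum_i 'd (F i) x v * 'd f x (row i B).
  pose u := \row_i 'd (F i) x v.
  (* This direction is killed by every ['d (F i) x], so it and its opposite both realise the zero
     pattern. *)
  have dw : 'd f x (v - u *m B) = 0.
    have ker i : 'd (F i) x (v - u *m B) = 0 by rewrite linearB/= dFB mxE subrr.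
    apply/le_anti/andP; split; last exact: admissible_diff_ge0 adm0 ker.
    rewrite -oppr_ge0 -linearN; apply: admissible_diff_ge0 adm0 _ => i.
    by rewrite linearN/= ker oppr0.
  move/eqP: dw; rewrite linearB/= subr_eq0 => /eqP ->; rewrite dfB.
  by apply: eq_bigr => i _; rewrite mxE.
apply/rowP => j; rewrite summxE mxE deriveE ?df; last exact: f_C1.1.
apply: eq_bigr => i _; rewrite !mxE mulrC deriveE//; exact: (F_C1 i).1.
Qed.

End multipliers.

(** * Multipliers for a sequence of constraints with free gradients *)

Lemma free_dual_basis (R : realType) n (K : Type) (ks : seq K)
    (a : K -> 'rV[R]_n) : free [seq a k | k <- ks] ->
  exists B : 'M[R]_(size ks, n), forall (u : 'rV[R]_(size ks)) i,
    \sum_j (u *m B) 0 j * a (tnth (in_tuple ks) i) 0 j = u 0 i.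
Proof.
move=> aF; pose A := \matrix_(i < size ks) a (tnth (in_tuple ks) i).
have Afree : row_free A.
  apply: inj_row_free => v; rewrite mulmx_sum_row => vA.
  have /freeP := (aF : free (map_tuple a (in_tuple ks))).
  move=> /(_ (fun i => v 0 i)) => v0.
  apply/rowP => i; rewrite mxE; apply: v0.
  rewrite -[RHS]vA; apply: eq_bigr => {}i _; rewrite rowK.
  by rewrite -tnth_nth tnth_map.
(* The transpose of a right inverse of [A] has rows dual to the rows of [A]. *)
have := mulmxVp Afree; move: (pinvmx A) => B AB; exists B^T => u i.
rewrite -[u in RHS]mulmx1 -trmx1 -AB trmx_mul mulmxA [RHS]mxE.
by apply: eq_bigr => j _; rewrite !mxE.
Qed.

Section sequence_multipliers.
Variables (R : realType) (n : nat) (K : finType) (F : K -> 'rV[R]_n -> R).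
Variables (x : 'rV[R]_n) (ks : seq K) (f : 'rV[R]_n -> R) (S : set 'rV[R]_n).
Hypothesis F_C1 : forall k, C1 (F k).
Hypothesis Fx0 : forall k, k \in ks -> F k x = 0.
Hypothesis F_free : free [seq grad (F k) x | k <- ks].
Hypothesis f_C1 : C1 f.
Hypothesis fmin : \forall y \near x, S y -> f x <= f y.

Definition admissible (c : K -> R) := \forall y \near x,
  forall t, 0 < t -> (forall k, k \in ks -> F k y = t * c k) -> S y.

Lemma multipliers_exist : admissible (fun=> 0) ->
  exists lam : K -> R,
    [/\ forall k, k \notin ks -> lam k = 0,
        grad f x = \sum_k lam k *: grad (F k) x &
        forall c, admissible c -> 0 <= \sum_k c k * lam k].
Proof.
move=> adm0; have [B BF] := free_dual_basis F_free.
pose key i := tnth (in_tuple ks) i; pose G i := F (key i).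
have dGB (u : 'rV[R]_(size ks)) i : 'd (G i) x (u *m B) = u 0 i.
  have dG : differentiable (G i) x by exact: (F_C1 (key i)).1.
  rewrite -BF -deriveE// derive_coord_sum//.
  by apply: eq_bigr => j _; rewrite [grad _ _ _ _]mxE.
have adm c : admissible c -> \forall y \near x,
    forall t, 0 < t -> (forall i, G i y = t * c (key i)) -> S y.
  apply: filterS => y Sy t t0 Gy.
  by apply: (Sy t t0) => k /seq_tnthP[i ->]; exact: Gy.
have [gradE sgn] := constrained_multipliers (fun i => F_C1 (key i))
  (fun i => Fx0 (mem_tnth i (in_tuple ks))) dGB f_C1 fmin (adm _ adm0).
(* All positions carrying [k] are collected; off [ks] the empty sum gives 0. *)
exists (fun k => \sum_(i | key i == k) 'd f x (row i B)); split.
- move=> k kks; rewrite big_pred0// => i; apply: contraNF kks => /eqP <-.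
  exact: mem_tnth.
- rewrite gradE (partition_big key xpredT)//=; apply: eq_bigr => k _.
  by rewrite scaler_suml; apply: eq_bigr => i /eqP <-.
- move=> c /adm/sgn; rewrite (partition_big key xpredT)//=.
  congr (_ <= _); apply: eq_bigr => k _.
  by rewrite mulr_sumr; apply: eq_bigr => i /eqP <-.
Qed.

End sequence_multipliers.

(** * Active constraints and admissible patterns of the MPBVC *)

Section mpbvc_multipliers.
Variables (R : realType) (n ng nh nH nG : nat) (P : mpbvc R n ng nh nH nG).
Variable x : 'rV[R]_n.

Local Notation index := (('I_ng + 'I_nh) + ('I_nH + 'I_nH * 'I_nG))%type.

Definition constraint (k : index) : 'rV[R]_n -> R :=
  match k with
  | inl (inl k) => fun y => eqg P y 0 k
  | inl (inr l) => fun y => ineqh P y 0 l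
  | inr (inl i) => bvcH P i
  | inr (inr ij) => bvcG P ij.1 ij.2
  end.

(** The order is that of [BVC_LICQ], so taking gradients yields the same sequence. *)
Definition active : seq index :=
  [seq inl (inl k) | k : 'I_ng] ++ [seq inl (inr l) | l in Ih P x]
  ++ [seq inr (inl i) | i in I0H P x]
  ++ [seq inr (inr ij) | ij in (Izz P x :|: Ipz P x)%SET].

Lemma BVC_LICQ_active : BVC_LICQ P x ->
  free [seq grad (constraint k) x | k <- active].
Proof. by rewrite /BVC_LICQ /active !map_cat /image_mem -!map_comp. Qed.

Lemma mem_active k : (k \in active) =
  match k with
  | inl (inl k) => true
  | inl (inr l) => l \in Ih P x
  | inr (inl i) => i \in I0H P x
  | inr (inr ij) => ij \in (Izz P x :|: Ipz P x)%SET
  end.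
Proof.
rewrite /active !mem_cat; apply/idP/idP => [|kP].
  by case/or4P => /mapP[a]; rewrite mem_enum => aP ->.
by case: k kP => [[k|l]|[i|ij]] kP; apply/or4P;
  [apply: Or41|apply: Or42|apply: Or43|apply: Or44];
  by apply: map_f; rewrite mem_enum.
Qed.

Hypothesis P_C2 : mpbvc_C2 P.
Hypothesis x_feasible : feasible P x.

Lemma constraint_C1 k : C1 (constraint k).
Proof.
have [_ [g1 _] [h1 _] H1 G1] := P_C2.
case: k => [[k|l]|[i|ij]] /=; try exact: C1_coord.
  exact: (H1 i).1.
exact: (G1 _ _).1.
Qed.

Lemma active_eq0 k : k \in active -> constraint k x = 0.
Proof.
rewrite mem_active; have [g0 _ _ _] := x_feasible.
case: k => [[k|l]|[i|ij]] /=.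
- by rewrite g0 mxE.
- by rewrite inE => /eqP.
- by rewrite inE => /eqP.
- by rewrite !inE => /orP[] /andP[_ /eqP].
Qed.

Lemma constraint_gt0_near k : 0 < constraint k x ->
  \forall y \near x, 0 < constraint k y.
Proof.
move=> k0; have /differentiable_continuous : differentiable (constraint k) x.
  exact: (constraint_C1 k).1.
by move=> /cvgr_gt; apply.
Qed.

(** Near [x] positive constraints stay positive and active ones equal [t * c]. On [Izz] the product
    is [t * t] times a product of pattern values; on [Izm] the pattern must keep [H_i] at 0, as
    [G_ij] is negative. *)
Lemma feasible_admissible (c : index -> R) :
  (forall k, c (inl (inl k)) = 0) ->
  (forall l, 0 <= c (inl (inr l))) ->
  (forall i, 0 <= c (inr (inl i))) ->
  (forall i j, (i, j) \in Ipz P x -> 0 <= c (inr (inr (i, j)))) ->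
  (forall i j, (i, j) \in Izz P x ->
    0 <= c (inr (inr (i, j))) * c (inr (inl i))) ->
  (forall i j, (i, j) \in Izm P x -> c (inr (inl i)) = 0) ->
  admissible constraint x active (feasible P) c.
Proof.
move=> cg ch cH cpz czz czm; have [_ h0 H0 GH0] := x_feasible.
have keep : \forall y \near x, forall k,
    0 < constraint k x -> 0 < constraint k y.
  apply: (@filter_forall _ _ _ _ (nbhs_filter x)) => k.
  have [k0|k0] := boolP (0 < constraint k x); last exact: nearW.
  by apply: filterS (constraint_gt0_near k0).
near=> y => t t0 cy.
have keepy : forall k, 0 < constraint k x -> 0 < constraint k y by near: y.
have Hy i : bvcH P i x = 0 -> bvcH P i y = t * c (inr (inl i)).
  by move=> Hi; apply: (cy (inr (inl i))); rewrite mem_active inE Hi.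
have Gy i j : (i, j) \in (Izz P x :|: Ipz P x)%SET ->
    bvcG P i j y = t * c (inr (inr (i, j))).
  by move=> Gij; apply: (cy (inr (inr (i, j)))); rewrite mem_active.
have Hy0 i : 0 <= bvcH P i y.
  have [/Hy ->|Hi] := eqVneq (bvcH P i x) 0; first by rewrite mulr_ge0// ltW.
  by apply/ltW/(keepy (inr (inl i))); rewrite lt_neqAle eq_sym Hi H0.
split=> //.
- apply/rowP => k; rewrite mxE -[LHS]/(constraint (inl (inl k)) y).
  by rewrite cy ?mem_active// cg mulr0.
- move=> l; have [hl|hl] := eqVneq (ineqh P x 0 l) 0.
    rewrite -[leRHS]/(constraint (inl (inr l)) y) cy ?mulr_ge0 ?(ltW t0)//.
    by rewrite mem_active inE hl.
  by apply/ltW/(keepy (inl (inr l))); rewrite lt_neqAle eq_sym hl h0.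
- move=> i j; have [Hi|Hi] := eqVneq (bvcH P i x) 0.
    have [Gij|Gij|Gij] := ltgtP (bvcG P i j x) 0.
    + by rewrite Hy// (czm i j) ?mulr0// inE Hi eqxx.
    + by rewrite mulr_ge0//; apply/ltW/(keepy (inr (inr (i, j)))).
    + have ijzz : (i, j) \in Izz P x by rewrite inE Hi Gij eqxx.
      rewrite Hy// Gy ?finset.in_setU ?ijzz// mulrACA.
      by rewrite mulr_ge0 ?czz// mulr_ge0 ?ltW.
  have {}Hi : 0 < bvcH P i x by rewrite lt_neqAle eq_sym Hi H0.
  (* Positivity of [H_i] forces [G_ij] to be nonnegative at [x]: it is either active, in [Ipz], or
     stays positive. *)
  rewrite mulr_ge0//; have := GH0 i j; rewrite pmulr_lge0//.
  rewrite le_eqVlt eq_sym => /orP[Gij|Gij]; last first.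
    by apply/ltW/(keepy (inr (inr (i, j)))).
  have ijpz : (i, j) \in Ipz P x by rewrite inE Hi Gij.
  by rewrite Gy ?mulr_ge0 ?cpz ?(ltW t0)// finset.in_setU ijpz orbT.
Unshelve. all: by end_near. Qed.

End mpbvc_multipliers.

Theorem corollary13 (R : realType) (n ng nh nH nG : nat)
    (nH_gt0 : (0 < nH)%N) (nG_gt0 : (0 < nG)%N)
    (P : mpbvc R n ng nh nH nG) (P_C2 : mpbvc_C2 P) (x : 'rV[R]_n) :
  locally_optimal P x -> BVC_LICQ P x -> strongly_stationary P x.
Proof.
move=> [xF fmin] /BVC_LICQ_active licq.
have [[f_C1 _] _ _ _ _] := P_C2; have [g0 h0 H0 _] := xF.
have adm := feasible_admissible P_C2 xF.
have [|lam [lam0 gradE sgn]] := multipliers_exist (constraint_C1 P_C2)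
  (active_eq0 xF) licq f_C1 fmin.
  by apply: adm => *; rewrite ?mulr0.
have sgn1 k : admissible (constraint P) x (active P x) (feasible P)
    (fun k' => (k' == k)%:R) -> 0 <= lam k.
  move=> /sgn; rewrite (bigD1 k)//= eqxx mul1r big1 ?addr0// => k' /negbTE ->.
  by rewrite mul0r.
have sgnN1 k : admissible (constraint P) x (active P x) (feasible P)
    (fun k' => - (k' == k)%:R) -> lam k <= 0.
  move=> /sgn; rewrite (bigD1 k)//= eqxx mulN1r big1 ?addr0 ?oppr_ge0// => k'.
  move=> /negbTE ->; by rewrite oppr0 mul0r.
exists (\row_k lam (inl (inl k))), (\row_l lam (inl (inr l))),
  (\matrix_(i, j) lam (inr (inr (i, j)))), (\row_i lam (inr (inl i))).
split => //.
- apply/eqP; rewrite !subr_eq add0r gradE !big_sumType/= pair_bigA/=.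
  rewrite addrC [X in _ + X]addrC addrA; apply/eqP.
  by congr (_ + _ + _ + _); apply: eq_bigr => k _;
    rewrite mxE -?surjective_pairing.
- move=> l; rewrite mxE; split=> //.
    by apply: sgn1; apply: adm => * //; rewrite mulr0.
  have [->|hl] := eqVneq (ineqh P x 0 l) 0; first by rewrite mulr0.
  by rewrite lam0 ?mul0r// mem_active inE.
- split=> i; rewrite mxE.
    rewrite !inE => iP; apply: lam0; rewrite mem_active inE.
    by case/orP: iP => /existsP[j]; rewrite inE => /andP[/gt_eqF->].
  (* Raising [H_i] alone could only violate the [Izm] condition at an index [(i, j)], which [iNzm]
     excludes. *)
  move=> iH iNzm; apply: sgn1; apply: adm => //.
  move=> i' j ijzm; apply/eqP; rewrite pnatr_eq0 eqb0.
  apply: contraNneq iNzm => -[<-]; rewrite inE.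
  by apply/existsP; exists j.
- split=> i j; rewrite mxE => ijpz.
    by apply: sgn1; apply: adm => * //; rewrite mulr0.
  have [ijzz|ijNzz] := boolP ((i, j) \in Izz P x); last first.
    by apply: lam0; rewrite mem_active inE negb_or ijNzz.
  (* On [Izz], [G_ij] may move either way: the pattern is 0 at [H_i], and the sign condition on
     [Ipz] does not concern [(i, j)]. *)
  apply/le_anti/andP; split.
    apply: sgnN1; apply: adm => [*|*|*|i' j' ijpz'|*|*];
      rewrite /= ?oppr0 ?mulr0//.
    by rewrite oppr_ge0; case: eqP ijpz => // -[<- <-]; rewrite ijpz'.
  by apply: sgn1; apply: adm => * //; rewrite mulr0.
Qed.
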